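(* Let $r\geq 2$ be an integer and let $f$ be an arithmetic function. Assume that there exists $\alpha\in[0,1)$ such that $$f(n)\ll n^{\alpha},$$ and that, for some $\beta\geq 0$, $$\sum_{n\leq x}f(n)\ll x(\log\log x)^{\beta}.$$ Then $$S_{f,r}(x)=x\sum_{j=0}^{r-1}\sum_{i=0}^{j}\binom{j}{i}(-1)^{i}a_{j}C_{i}(\log x)^{j-i}+\mathcal{O}\left(x(\log x)^{r-2}(\log\log x)^{\beta}\right),$$ where $C_{i}$ and $a_{j}$ ($0\leq i\leq j\leq r-1$) are real constants.
   Context: An arithmetic function is a function defined on the positive integers. $\lfloor t\rfloor$ denotes the integer part of the number $t$. For an arithmetic function $f$ and an integer $r\geq 2$, $$S_{f,r}(x)=\sum_{n_{1}n_{2}\cdots n_{r}\leq x}f\left(\left\lfloor\frac{x}{n_{1}n_{2}\cdots n_{r}}\right\rfloor\right),$$ where the sum runs over all $r$-tuples $(n_1,\dots,n_r)$ of positive integers with $n_1n_2\cdots n_r\leq x$. The notation $A\ll B$ means $A=\mathcal{O}(B)$. Estimates in $x$ are asymptotic, as $x\to\infty$, and ''constants'' means quantities independent of $x$. *)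

(* Defs.v *)
From HB Require Import structures.
From mathcomp Require Import all_boot all_order all_algebra.
From mathcomp Require Import all_classical all_reals all_analysis.
Set Implicit Arguments.
Unset Strict Implicit.
Unset Printing Implicit Defensive.
Import Order.TTheory GRing.Theory Num.Theory.
Import numFieldNormedType.Exports.
Local Open Scope ring_scope.

(* Arithmetic functions are rendered as [f : nat -> R]; the value [f 0] is
   never used below. For real [x >= 0], [Num.truncn x] is the integer part. *)

Definition summatory (R : realType) (f : nat -> R) (x : R) : R :=
  \sum_(1 <= n < (Num.truncn x).+1) f n.

(* The sum of f(floor(x / (n_1 ... n_r))) over all r-tuples of positive
   integers with n_1 ... n_r <= x. Each n_i is then at most the integer part
   of x, so letting the n_i range over 'I_(truncn x).+1 loses no tuple. *)
Definition Ssum (R : realType) (f : nat -> R) (r : nat) (x : R) : R :=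
  \sum_(n : {ffun 'I_r -> 'I_(Num.truncn x).+1} |
          [forall i, 0 < n i]%N && ((\prod_i n i)%N%:R <= x))
     f (Num.truncn (x / (\prod_i n i)%N%:R)).

(* The library has no such instance; without it [=O_+oo] does not typecheck. *)
Canonical pinfty_filter_on (R : numFieldType) :=
  @FilterType R (pinfty_nbhs R) (@filter_filter R _ proper_pinfty_nbhs).

(* Main.v *)
(** Summing over n_1 first gives S_{f,r+1}(x) = sum_{n <= x} S_{f,r}(x/n).
    The bound f(n) << n^alpha alone yields S_{f,1}(x) = c x + O(x^t) with
    t = (1 + alpha)/2 < 1 and c = sum_m f(m)/(m(m+1)). Since
    sum_{n <= x} (x/n)^t << x and
    sum_{n <= x} (1/n) (log(x/n))^j = (log x)^(j+1)/(j+1) + O((log x)^j),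
    induction on r gives
    S_{f,r}(x) = c x (log x)^(r-1)/(r-1)! + O(x (1 + log x)^(r-2)).
    As log log x >= 1 eventually, all terms of degree below r - 1 in log x are
    absorbed by the error term, so only a_(r-1) and C_0 are taken nonzero. *)

Require Import Defs.
From mathcomp Require Import all_boot all_order all_algebra.
From mathcomp Require Import all_classical all_reals all_analysis.
From mathcomp Require Import ring lra.
Import Order.TTheory GRing.Theory Num.Theory.
Import numFieldNormedType.Exports.
Local Open Scope classical_set_scope.
Local Open Scope ring_scope.

(** * Tuple sums as iterated dilation sums *)

Definition dilation_sum {R : realType} (h : R -> R) (x : R) : R :=
  \sum_(1 <= n < (Num.truncn x).+1) h (x / n%:R).

Definition ffun_cons {T : finType} {r} (k : T) (n : {ffun 'I_r -> T}) :
    {ffun 'I_r.+1 -> T} :=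
  [ffun i => oapp n k (unlift ord0 i)].

Lemma ffun_cons0 {T : finType} {r} (k : T) (n : {ffun 'I_r -> T}) :
  ffun_cons k n ord0 = k.
Proof. by rewrite ffunE unlift_none. Qed.

Lemma ffun_cons_lift {T : finType} {r} (k : T) (n : {ffun 'I_r -> T}) i :
  ffun_cons k n (lift ord0 i) = n i.
Proof. by rewrite ffunE liftK. Qed.

Lemma sum_ffun_recl {V : nmodType} {T : finType} {r}
    (P : pred {ffun 'I_r.+1 -> T}) (F : {ffun 'I_r.+1 -> T} -> V) :
  \sum_(n | P n) F n =
  \sum_(k : T) \sum_(n : {ffun 'I_r -> T} | P (ffun_cons k n))
     F (ffun_cons k n).
Proof.
rewrite pair_big_dep /=.
pose split_ffun (n : {ffun 'I_r.+1 -> T}) := (n ord0, [ffun i => n (lift ord0 i)]).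
apply: (reindex (fun p : T * {ffun 'I_r -> T} => ffun_cons p.1 p.2)).
exists split_ffun => [[k n]|n] _ /=.
  rewrite /split_ffun ffun_cons0; congr pair.
  by apply/ffunP => i; rewrite ffunE ffun_cons_lift.
apply/ffunP => i; rewrite ffunE.
by case: unliftP => [j ->|->] //=; rewrite ffunE.
Qed.

(* The bound M is decoupled from [truncn x] so that the induction can pass from
   x to x / k over the same index type. *)
Lemma bounded_tuple_sum {R : realType} (f : nat -> R) (r M : nat) (x : R) :
    1 <= x -> (Num.truncn x <= M)%N ->
  \sum_(n : {ffun 'I_r -> 'I_M.+1} |
          [forall i, 0 < n i]%N && ((\prod_i n i)%N%:R <= x))
     f (Num.truncn (x / (\prod_i n i)%N%:R)) =
  iter r dilation_sum (f \o Num.truncn) x.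
Proof.
elim: r x => [|r IHr] x x1 xM.
  rewrite (bigD1 [ffun i : 'I_0 => ord0]) /=; last first.
    by apply/andP; split; [apply/forallP => -[] | rewrite big_ord0].
  rewrite big_ord0 divr1 big1 ?addr0// => n /andP[_ /eqP[]].
  by apply/ffunP => -[].
have x0 : 0 <= x by apply: le_trans x1.
have consE (k : 'I_M.+1) (n : {ffun 'I_r -> 'I_M.+1}) :
    (\prod_i ffun_cons k n i = k * \prod_i n i)%N.
  rewrite big_ord_recl ffun_cons0; congr muln.
  by apply: eq_bigr => i _; rewrite ffun_cons_lift.
have consP (k : 'I_M.+1) (n : {ffun 'I_r -> 'I_M.+1}) :
    [forall i, 0 < ffun_cons k n i]%N = (0 < k)%N && [forall i, 0 < n i]%N.
  apply/forallP/andP => [H|[k0 /forallP H] i].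
    split; first by have := H ord0; rewrite ffun_cons0.
    by apply/forallP => i; have := H (lift ord0 i); rewrite ffun_cons_lift.
  by rewrite ffunE; case: unliftP => [j _|_] //=.
rewrite sum_ffun_recl /= {1}/dilation_sum.
rewrite (big_nat_widen _ _ M.+1)//.
rewrite (big_nat_widenl 1 0)// big_mkord [RHS]big_mkcond /=.
apply: eq_bigr => k _; rewrite andbC ltnS.
under eq_bigl => n do rewrite consP consE.
under eq_bigr => n _ do rewrite consE.
case: ifP => [/andP[k0 kx]|kF]; last first.
  (* When [k] is zero or exceeds [x], it extends to no admissible tuple, since the other factors
     have product at least 1. *)
  rewrite big_pred0// => n; apply/negbTE/negP => /andP[/andP[k0 /forallP n0] le_x].
  move: kF; rewrite k0 /= truncn_ge_nat// => /negbT; rewrite -ltNge => xk.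
  suff : x < (k * \prod_i n i)%N%:R by rewrite ltNge le_x.
  apply: (lt_le_trans xk).
  by rewrite ler_nat leq_pmulr// prodn_gt0.
have kR : 0 < k%:R :> R by rewrite ltr0n.
rewrite -IHr.
- apply: eq_big => [n|n _].
    by rewrite k0 /= natrM ler_pdivlMr// mulrC.
  by rewrite natrM invfM mulrA.
- by rewrite ler_pdivlMr// mul1r -truncn_ge_nat.
- apply: leq_trans xM; apply: le_truncn.
  by rewrite ler_pdivrMr// ler_peMr// ler1n.
Qed.

Lemma SsumE {R : realType} (f : nat -> R) (r : nat) (x : R) : 1 <= x ->
  Ssum f r x = iter r dilation_sum (f \o Num.truncn) x.
Proof. by move=> x1; exact: bounded_tuple_sum. Qed.

(** * Elementary inequalities for real powers *)

(** Concavity of y^d at 1. For d < 1 it is Young's inequality for the pair y^d, 1 with conjugate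
    exponents 1/d and 1/(1-d). *)
Lemma powR_le_tangent {R : realType} (d y : R) : 0 < d <= 1 -> 0 <= y ->
  y `^ d <= 1 + d * (y - 1).
Proof.
move=> /andP[d0]; rewrite le_eqVlt => /predU1P[-> y0|d1 y0].
  by rewrite powRr1//; lra.
have d1' : 0 < 1 - d by lra.
have := @conjugate_powR R (y `^ d) 1 d^-1 (1 - d)^-1 (powR_ge0 _ _) ler01.
rewrite !invr_gt0 !invrK => /(_ d0 d1').
rewrite -powRrM mulfV ?gt_eqF// powRr1// powR1 mulr1 => H.
by apply: le_trans (H _) _; lra.
Qed.

Lemma powR_scale {R : realType} (d x y : R) : 0 <= x -> 0 < y ->
  x `^ d = y `^ d * (x / y) `^ d.
Proof.
move=> x0 y0; rewrite -powRM ?divr_ge0// ?(ltW y0)//.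
by rewrite mulrCA divff ?gt_eqF// mulr1.
Qed.

(** The tangent bound at (n-1)/n gives d n^(d-1) <= n^d - (n-1)^d, which telescopes; the boundary
    value 0^d vanishes because d > 0. *)
Lemma sum_powR_le {R : realType} (d : R) (Q : nat) : 0 < d <= 1 ->
  \sum_(1 <= n < Q.+1) n%:R `^ (d - 1) <= Q%:R `^ d / d.
Proof.
move=> d01; have /andP[d0 d1] := d01.
rewrite ler_pdivlMr// mulr_suml.
apply: (@le_trans _ _ (\sum_(1 <= n < Q.+1) (n%:R `^ d - n.-1%:R `^ d))).
  apply: ler_sum_nat => -[//|n] _ /=.
  have n0 : 0 < n.+1%:R :> R by rewrite ltr0n.
  rewrite (powR_scale d n%:R n.+1%:R)// -(mulr_powRB1 (ltW n0) d0).
  have := powR_le_tangent d (n%:R / n.+1%:R) d01 (divr_ge0 (ler0n _ _) (ltW n0)).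
  set t := _ `^ d => tle.
  have p0 := powR_gt0 (d - 1) n0.
  have -> : n.+1%:R * n.+1%:R `^ (d - 1) - n.+1%:R * n.+1%:R `^ (d - 1) * t
    = n.+1%:R `^ (d - 1) * (n.+1%:R * (1 - t)) by ring.
  rewrite ler_pM2l//.
  apply: (@le_trans _ _ (n.+1%:R * (d * (1 - n%:R / n.+1%:R)))); last first.
    rewrite ler_pM2l//; move: tle; set q := _ / _; set s := t; clearbody q; lra.
  by rewrite -natr1; rewrite le_eqVlt; apply/predU1P; left; field; rewrite natr1 gt_eqF.
rewrite big_add1 /= telescope_sumr//.
by rewrite powR0 ?subr0// gt_eqF.
Qed.

(** Factoring out m^(-d) reduces this to the tangent bound at m/(m+1). For d = 1 - a the left side
    is, up to a constant, the bound on |f(m)|/(m(m+1)). *)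
Lemma powRN_telescope_ge {R : realType} (d : R) (m : nat) : 0 < d <= 1 ->
    (0 < m)%N ->
  d * (m%:R `^ (1 - d) / (m%:R * m.+1%:R)) <= m%:R `^ (- d) - m.+1%:R `^ (- d).
Proof.
move=> d01 m0; have /andP[d0 d1] := d01.
have mR : 0 < m%:R :> R by rewrite ltr0n.
have m1R : 0 < m.+1%:R :> R by rewrite ltr0n.
have mD : m%:R `^ (1 - d) = m%:R * m%:R `^ (- d) :> R.
  by rewrite powRD ?powRr1 ?ltW// (gt_eqF mR) implybT.
rewrite mD.
rewrite [m.+1%:R `^ _](powR_scale _ _ m%:R)//.
have -> : (m.+1%:R / m%:R) `^ (- d) = (m%:R / m.+1%:R) `^ d :> R.
  rewrite -[m.+1%:R / _]invf_div -[(m%:R / _)^-1]powR_inv1 ?divr_ge0//.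
  by rewrite -powRrM mulN1r opprK.
have := powR_le_tangent d (m%:R / m.+1%:R) d01 (divr_ge0 (ltW mR) (ltW m1R)).
set t := _ `^ d => tle.
have p0 := powR_gt0 (- d) mR.
have -> : m%:R * m%:R `^ (- d) / (m%:R * m.+1%:R) = m%:R `^ (- d) / m.+1%:R.
  by rewrite -mulf_div divff ?mul1r// gt_eqF.
rewrite mulrCA -[leRHS](_ : m%:R `^ (- d) * (1 - t) = _); last by ring.
rewrite ler_pM2l//.
apply: (@le_trans _ _ (d * (1 - m%:R / m.+1%:R))).
  rewrite le_eqVlt; apply/predU1P; left; rewrite -natr1; field.
  by rewrite natr1 gt_eqF.
by move: tle; set q := _ / _; clearbody t q; lra.
Qed.

(** * First-order asymptotics of sums over integer quotients *)

(** Two partial sums differ by at most the drop of [p] between them. Where [p] tends to 0, [c] is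
    the sum of the series and the bound controls its tail. *)
Lemma telescoping_limit {R : realType} (u p : nat -> R) :
    (forall m, 0 <= p m) ->
    (forall m, (0 < m)%N -> `|u m| <= p m - p m.+1) ->
  exists c, forall M, `|c - \sum_(1 <= m < M.+1) u m| <= p M.+1.
Proof.
move=> p0 up; pose A M := \sum_(1 <= m < M.+1) u m.
have AD M k : `|A (M + k)%N - A M| <= p M.+1 - p (M + k).+1.
  elim: k => [|k IHk]; first by rewrite addn0 !subrr normr0.
  rewrite addnS /A big_nat_recr//= -/(A _) addrAC.
  apply: (le_trans (ler_normD _ _)).
  have := up (M + k).+1 isT; lra.
pose B := [set A M - p M.+1 | M in setT].
have ubB M : ubound B (A M + p M.+1).
  move=> _ [M' _ <-]; have [le|/ltnW le] := leqP M M'.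
    have := AD M (M' - M)%N; rewrite subnKC// ler_norml => /andP[_].
    have := p0 M'.+1; lra.
  have := AD M' (M - M')%N; rewrite subnKC// ler_norml => /andP[+ _].
  have := p0 M.+1; lra.
(* The partial sums A M -/+ p M.+1 are monotone and squeeze the limit. *)
exists (sup B) => M; rewrite -/(A M) ler_norml; apply/andP; split.
  have : A M - p M.+1 <= sup B by apply: ub_le_sup; [exists (A M + p M.+1) | exists M].
  lra.
have : sup B <= A M + p M.+1 by apply: ge_sup => //; exists (A M - p M.+1); exists M.
lra.
Qed.

(** Both m <= N/n and n <= N/m say that m n <= N. *)
Lemma sum_divn_ge {R : realType} (N m : nat) : (0 < m)%N ->
  \sum_(1 <= n < N.+1) (m <= N %/ n)%N%:R = (N %/ m)%:R :> R.
Proof.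
move=> m0; rewrite -natr_sum; congr (_%:R).
have -> : (\sum_(1 <= n < N.+1) nat_of_bool (m <= N %/ n) =
    \sum_(1 <= n < N.+1 | n < (N %/ m).+1) 1)%N.
  rewrite [RHS]big_mkcond; apply: eq_big_nat => n /andP[n0 _].
  by rewrite leq_divRL// mulnC -leq_divRL// ltnS; case: leqP.
rewrite -(big_nat_widen 1 (N %/ m).+1 N.+1 predT (fun=> 1%N)) ?ltnS ?leq_div//.
by rewrite sum_nat_const_nat subn1 muln1.
Qed.

(** Grouping by the value m of the quotient: by the preceding count, exactly [N %/ m - N %/ m.+1] of
    the n take it. *)
Lemma sum_divn_le {R : realType} (f : nat -> R) (N M : nat) :
  \sum_(1 <= n < N.+1 | (N %/ n <= M)%N) f (N %/ n)%N =
  \sum_(1 <= m < M.+1) f m * ((N %/ m)%:R - (N %/ m.+1)%:R).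
Proof.
transitivity (\sum_(1 <= m < M.+1) \sum_(1 <= n < N.+1)
    f m * (N %/ n == m)%N%:R); last first.
  apply: eq_big_nat => m /andP[m0 _].
  rewrite -(@sum_divn_ge R N m)// -(@sum_divn_ge R N m.+1)// -sumrB -mulr_sumr.
  congr (_ * _); apply: eq_bigr => n _.
  by case: ltngtP; rewrite ?subrr ?subr0.
rewrite exchange_big /= [LHS]big_mkcond; apply: eq_big_nat => n /andP[n0 nN].
have d0 : (0 < N %/ n)%N by rewrite divn_gt0.
case: leqP => [dM|Md].
  rewrite (bigD1_seq (N %/ n)%N) ?iota_uniq//=; last by rewrite mem_index_iota d0.
  rewrite eqxx mulr1 big1 ?addr0// => m; rewrite eq_sym => /negPf ->.
  by rewrite mulr0.
rewrite big_nat big1// => m /andP[_ mM].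
by rewrite gtn_eqF ?mulr0// (leq_trans mM).
Qed.

Lemma divn_real_itv {R : realType} (N m : nat) : (0 < m)%N ->
  (N %/ m)%:R <= (N%:R / m%:R : R) < (N %/ m)%:R + 1.
Proof.
move=> m0; have mR : 0 < m%:R :> R by rewrite ltr0n.
rewrite natr1 ler_pdivlMr// ltr_pdivrMr// -!natrM ler_nat ltr_nat.
by rewrite leq_divM ltn_ceil.
Qed.

(** Here [c] is the sum of f(m)/(m(m+1)). Cutting the quotients at sqrt N balances three errors,
    from rounding, large quotients and the series tail: each has order N^((1+a)/2). *)
Lemma sum_divn_asymptotic {R : realType} (f : nat -> R) (a K : R) :
    0 <= a < 1 -> 0 <= K ->
    (forall n, (0 < n)%N -> `|f n| <= K * n%:R `^ a) ->
  exists c K', 0 <= K' /\ forall N, (0 < N)%N ->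
    `|\sum_(1 <= n < N.+1) f (N %/ n)%N - c * N%:R|
      <= K' * N%:R `^ ((1 + a) / 2).
Proof.
move=> /andP[a0 a1] K0 fK; pose d := 1 - a.
have d01 : 0 < d <= 1 by rewrite /d; apply/andP; split; lra.
have /andP[d0 d1] := d01.
have Kd0 : 0 <= K / d by rewrite divr_ge0// ltW.
pose u m := f m / (m%:R * m.+1%:R).
pose p (m : nat) : R := K / d * m%:R `^ (- d).
have [c cP] : exists c, forall M, `|c - \sum_(1 <= m < M.+1) u m| <= p M.+1.
  (* |u m| is dominated by a telescoping difference, by concavity of y^d. *)
  apply: telescoping_limit => [m|m m0]; first by rewrite mulr_ge0// powR_ge0.
  rewrite /p -mulrBr; apply: le_trans (ler_wpM2l Kd0 (powRN_telescope_ge d m d01 m0)).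
  have KdK t : K / d * (d * t) = K * t by rewrite mulrA divfK ?gt_eqF.
  rewrite KdK /u normrM.
  rewrite [`|_^-1|]ger0_norm ?invr_ge0 ?mulr_ge0// mulrA.
  rewrite ler_wpM2r ?invr_ge0 ?mulr_ge0//.
  by have := fK m m0; rewrite /d opprB addrC subrK.
(* [K] pays for rounding, [2 * (K / d)] for the large quotients and [K / d] for the tail of the
   series. *)
exists c, (K + 3 * (K / d)); split; first by rewrite addr_ge0// mulr_ge0.
move=> N N0; have NR : 0 < N%:R :> R by rewrite ltr0n.
have N1 : 1 <= N%:R :> R by rewrite ler1n.
pose s : R := N%:R `^ 2^-1.
have ss : s * s = N%:R by rewrite -expr2 -powR_mulrn ?powR_ge0// -powRrM mulVf ?powRr1.
have s1 : 1 <= s by rewrite -(powRr0 N%:R) ler_powR.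
have s0 : 0 < s by apply: lt_le_trans s1.
have sX x : s `^ x = N%:R `^ (x / 2) by rewrite -powRrM mulrC.
pose M := Num.truncn s.
have M0 : (0 < M)%N by rewrite truncn_gt0.
have MR : 0 < M%:R :> R by rewrite ltr0n.
have Ms : M%:R <= s by rewrite truncn_le ltW.
have sM : s < M%:R + 1 by rewrite natr1 truncnS_gt.
pose E := N%:R `^ ((1 + a) / 2) : R.
(* Terms with N / n <= sqrt N are grouped by the value m of the quotient; the
   others, at most about sqrt N in number, are bounded trivially. *)
have small : `|\sum_(1 <= n < N.+1 | (N %/ n <= M)%N) f (N %/ n)%N
    - N%:R * \sum_(1 <= m < M.+1) u m| <= K * E.
  rewrite sum_divn_le mulr_sumr -sumrB.
  apply: (le_trans (ler_norm_sum _ _ _)).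
  apply: (@le_trans _ _ (\sum_(1 <= m < M.+1) K * s `^ a)).
    apply: ler_sum_nat => m /andP[m0]; rewrite ltnS => mM.
    have mR : 0 < m%:R :> R by rewrite ltr0n.
    (* Since 1/(m(m+1)) = 1/m - 1/(m+1), the second factor is a difference of two fractional parts,
       at most 1 in absolute value. *)
    have -> : f m * ((N %/ m)%:R - (N %/ m.+1)%:R) - N%:R * u m =
        f m * ((N %/ m)%:R - (N %/ m.+1)%:R - (N%:R / m%:R - N%:R / m.+1%:R)).
      by rewrite /u -natr1; field; rewrite natr1 !gt_eqF.
    rewrite normrM -[leRHS]mulr1; apply: ler_pM => //.
      apply: (le_trans (fK m m0)); rewrite ler_wpM2l//.
      apply: ge0_ler_powR; rewrite ?nnegrE ?(ltW s0)//.
      by apply: le_trans Ms; rewrite ler_nat.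
    have /andP[] := @divn_real_itv R N m m0.
    have /andP[] := @divn_real_itv R N m.+1 isT.
    set q1 := (N %/ m)%:R; set q2 := (N %/ m.+1)%:R.
    set r1 := _ / m%:R; set r2 := _ / m.+1%:R; clearbody q1 q2 r1 r2.
    by move=> *; rewrite ler_norml; apply/andP; split; lra.
  rewrite sumr_const_nat subn1/= -mulr_natl mulrCA ler_wpM2l//.
  apply: (le_trans (ler_wpM2r (powR_ge0 _ _) Ms)).
  rewrite -{1}(powRr1 (ltW s0)) -powRD ?(gt_eqF s0) ?implybT//.
  by rewrite sX.
have large : `|\sum_(1 <= n < N.+1 | ~~ (N %/ n <= M)%N) f (N %/ n)%N|
    <= 2 * (K / d) * E.
  apply: (le_trans (ler_norm_sum _ _ _)).
  pose Q := (N %/ M)%N.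
  apply: (@le_trans _ _ (\sum_(1 <= n < Q.+1) K * N%:R `^ a * n%:R `^ (d - 1))).
    rewrite [leRHS](big_nat_widen _ _ N.+1) ?ltnS ?leq_div//.
    rewrite big_mkcond [leRHS]big_mkcond; apply: ler_sum_nat => n /andP[n0 nN].
    have nR : 0 < n%:R :> R by rewrite ltr0n.
    rewrite /= -ltnNge ltnS; case: ifP => [Mn|_]; last first.
      by case: ifP => // _; rewrite !mulr_ge0 ?powR_ge0.
    rewrite leq_divRL// mulnC -leq_divRL// ltnW//.
    apply: le_trans (fK _ _) _; first by rewrite divn_gt0.
    rewrite -mulrA ler_wpM2l//.
    have -> : N%:R `^ a * n%:R `^ (d - 1) = (N%:R / n%:R) `^ a.
      rewrite powRM ?invr_ge0 ?ltW//; congr (_ * _).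
      rewrite -powR_inv1 ?ltW// -powRrM mulN1r /d; congr (_ `^ _); lra.
    apply: ge0_ler_powR; rewrite ?nnegrE ?divr_ge0//.
    by have /andP[] := @divn_real_itv R N n n0.
  rewrite -mulr_sumr.
  apply: le_trans (ler_wpM2l _ (sum_powR_le d Q d01)) _.
    by rewrite mulr_ge0 ?powR_ge0.
  (* [M >= 1] and [s < M + 1] give s <= 2 M, so Q <= s^2/M <= 2 s; and 2^d <= 2 because d <= 1. *)
  have QE : Q%:R `^ d <= 2 * s `^ d.
    apply: (@le_trans _ _ ((2 * s) `^ d)).
      apply: ge0_ler_powR; rewrite ?nnegrE ?(ltW d0) ?mulr_ge0 ?(ltW s0)//.
      have /andP[QN _] := @divn_real_itv R N M M0.
      apply: le_trans QN _; rewrite ler_pdivrMr// -ss.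
      have M1 : 1 <= M%:R :> R by rewrite ler1n.
      by rewrite mulrAC ler_pM2r//; lra.
    by rewrite powRM ?(ltW s0)// ler_wpM2r ?powR_ge0// ler1_powR// ler1n.
  have EE : N%:R `^ a * s `^ d = E.
    rewrite sX -powRD ?(gt_eqF NR) ?implybT//; congr (_ `^ _).
    by rewrite /d; field.
  rewrite -EE.
  have := ler_wpM2l (mulr_ge0 Kd0 (powR_ge0 N%:R a)) QE.
  rewrite [X in X <= _ -> _](_ : _ = K * N%:R `^ a * (Q%:R `^ d / d)); last by field; rewrite gt_eqF.
  move/le_trans; apply; rewrite le_eqVlt; apply/predU1P; left; field; by rewrite gt_eqF.
(* The series tail beyond [M] is at most K/d (M+1)^(-d), and M + 1 exceeds sqrt N. *)
have tail : `|N%:R * \sum_(1 <= m < M.+1) u m - c * N%:R| <= K / d * E.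
  rewrite [c * _]mulrC -mulrBr normrM ger0_norm// distrC.
  apply: le_trans (ler_wpM2l (ltW NR) (cP M)) _.
  rewrite /p mulrCA ler_wpM2l//.
  have -> : E = N%:R * s `^ (- d).
    rewrite sX -{1}(powRr1 (ltW NR)) -powRD ?(gt_eqF NR) ?implybT//.
    by congr (_ `^ _); rewrite /d; field.
  rewrite ler_pM2l// !powRN lef_pV2 ?posrE ?powR_gt0//.
  by apply: ge0_ler_powR; rewrite ?nnegrE ?(ltW d0) ?(ltW s0)// -natr1 (ltW sM).
rewrite (bigID (fun n => N %/ n <= M)%N) /=.
move: small large tail; set X := \sum_(_ <= _ < _ | _) _; set Y := \sum_(_ <= _ < _ | _) _.
set Z := N%:R * _; rewrite -/E !ler_norml; clearbody X Y Z E.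
move=> /andP[? ?] /andP[? ?] /andP[? ?]; apply/andP; split; lra.
Qed.

(** * Passage from integer to real arguments *)

Lemma truncn_divn {R : realType} (y : R) (n : nat) : 0 <= y -> (0 < n)%N ->
  Num.truncn (y / n%:R) = (Num.truncn y %/ n)%N.
Proof.
move=> y0 n0; have nR : 0 < n%:R :> R by rewrite ltr0n.
apply: truncn_def; rewrite ler_pdivlMr// ltr_pdivrMr// -!natrM.
by rewrite -truncn_ge_nat// leq_divM -truncn_lt_nat// ltn_ceil.
Qed.

(** The sum depends on [y] only through its integer part N; replacing c N by c y costs at most |c|,
    absorbed because y^((1+a)/2) >= 1. *)
Lemma dilation_sum_truncn_asymptotic {R : realType} (f : nat -> R) (a K : R) :
    0 <= a < 1 -> 0 <= K ->
    (forall n, (0 < n)%N -> `|f n| <= K * n%:R `^ a) ->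
  exists c K', 0 <= K' /\ forall y, 1 <= y ->
    `|dilation_sum (f \o Num.truncn) y - c * y| <= K' * y `^ ((1 + a) / 2).
Proof.
move=> a01 K0 fK; have [c [K' [K'0 cP]]] := sum_divn_asymptotic f a K a01 K0 fK.
have /andP[a0 a1] := a01.
exists c, (K' + `|c|); split; first by rewrite addr_ge0.
move=> y y1; have y0 : 0 <= y by apply: le_trans y1.
set N := Num.truncn y.
have N0 : (0 < N)%N by rewrite truncn_gt0.
have Ny : N%:R <= y by rewrite truncn_le.
have yN : y < N%:R + 1 by rewrite natr1 truncnS_gt.
have t0 : 0 <= (1 + a) / 2 by lra.
have p1 : 1 <= y `^ ((1 + a) / 2) by rewrite -{1}(powRr0 y) ler_powR.
have -> : dilation_sum (f \o Num.truncn) y = \sum_(1 <= n < N.+1) f (N %/ n)%N.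
  by apply: eq_big_nat => n /andP[n0 _]; rewrite /= truncn_divn.
rewrite -(subrK (c * N%:R) (\sum_(1 <= n < N.+1) _)) -addrA -mulrBr mulrDl.
apply: (le_trans (ler_normD _ _)); apply: lerD.
  apply: (le_trans (cP N N0)); rewrite ler_wpM2l//.
  by apply: ge0_ler_powR; rewrite ?nnegrE.
rewrite normrM ler_wpM2l// ler_norml; apply/andP; split; lra.
Qed.

(** * Dilation sums of powers and of logarithms *)

(** Since (x/n)^t = x^t n^(-t), this is the power sum bound with d = 1 - t. *)
Lemma sum_powR_dilation {R : realType} (t : R) (x : R) : 0 <= t < 1 -> 1 <= x ->
  dilation_sum (fun y => y `^ t) x <= x / (1 - t).
Proof.
move=> /andP[t0 t1] x1.
have x0 : 0 < x by apply: lt_le_trans x1.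
have d01 : 0 < 1 - t <= 1 by apply/andP; split; lra.
have /andP[d0 d1] := d01.
have -> : dilation_sum (fun y => y `^ t) x =
    x `^ t * \sum_(1 <= n < (Num.truncn x).+1) n%:R `^ (1 - t - 1).
  rewrite mulr_sumr; apply: eq_big_nat => n /andP[n0 _].
  rewrite powRM ?invr_ge0 ?(ltW x0)//; congr (_ * _).
  by rewrite -powR_inv1// -powRrM mulN1r; congr (_ `^ _); lra.
apply: le_trans (ler_wpM2l (powR_ge0 _ _) (sum_powR_le _ _ d01)) _.
rewrite mulrA ler_wpM2r ?invr_ge0 ?(ltW d0)//.
apply: (@le_trans _ _ (x `^ t * x `^ (1 - t))).
  rewrite ler_wpM2l ?powR_ge0//; apply: ge0_ler_powR; rewrite ?nnegrE ?(ltW d0) ?(ltW x0)//.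
  by rewrite truncn_le ltW.
by rewrite -powRD ?(gt_eqF x0) ?implybT// addrC subrK powRr1// ltW.
Qed.

(** The middle is the integral of t^j over [v, u]. Once u - v is factored out of u^(j+1) - v^(j+1),
    each of the j+1 remaining terms lies between v^j and u^j. *)
Lemma subrXX_itv {R : realType} (u v : R) (j : nat) : 0 <= v <= u ->
  v ^+ j * (u - v) <= (u ^+ j.+1 - v ^+ j.+1) / j.+1%:R <= u ^+ j * (u - v).
Proof.
move=> /andP[v0 vu].
have u0 : 0 <= u by apply: le_trans vu.
have jR : 0 < j.+1%:R :> R by rewrite ltr0n.
rewrite ler_pdivlMr// ler_pdivrMr// !(mulrC _ (u - v)) -!mulrA subrXX.
rewrite !ler_wpM2l ?subr_ge0//= !mulr_natr.
  have := sumr_const 'I_j.+1 (u ^+ j); rewrite card_ord => <-.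
  apply: ler_sum => i _; have ij : (i <= j)%N by rewrite -ltnS.
  rewrite /= -[in leRHS](subnK ij) exprD ler_wpM2l ?exprn_ge0//.
  by rewrite lerXn2r ?nnegrE.
have := sumr_const 'I_j.+1 (v ^+ j); rewrite card_ord => <-.
apply: ler_sum => i _; have ij : (i <= j)%N by rewrite -ltnS.
rewrite /= -[in leLHS](subnK ij) exprD ler_wpM2r ?exprn_ge0//.
by rewrite lerXn2r ?nnegrE.
Qed.

(** Both bounds come from ln t <= t - 1, at (n+1)/n and at its inverse. *)
Lemma ln_succ_itv {R : realType} (n : nat) : (0 < n)%N ->
  n.+1%:R^-1 <= ln (n.+1%:R / n%:R : R) <= n%:R^-1.
Proof.
move=> n0; have nR : 0 < n%:R :> R by rewrite ltr0n.
have n1R : 0 < n.+1%:R :> R by rewrite ltr0n.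
have lnle (t : R) : 0 < t -> ln t <= t - 1.
  by move=> t0; rewrite -{1}(subrK 1 t) addrC le_ln1Dx// ltrBrDr addNr.
apply/andP; split; last first.
  apply: le_trans (lnle _ _) _; first by rewrite divr_gt0.
  by rewrite -natr1 mulrDl divff ?gt_eqF// mul1r addrC addrA addNr add0r.
rewrite -[leRHS]opprK -lnV ?posrE ?divr_gt0// invf_div lerNr.
apply: le_trans (lnle _ _) _; first by rewrite divr_gt0.
rewrite le_eqVlt; apply/predU1P; left; rewrite -natr1; field.
by rewrite natr1 gt_eqF.
Qed.

(** Comparison with the integral of ln(x/t)^j / t over [1, x], cut at the integers and
    telescoped. *)
Lemma sum_inv_lnX {R : realType} (x : R) (j : nat) : 1 <= x ->
  0 <= \sum_(1 <= n < (Num.truncn x).+1) n%:R^-1 * ln (x / n%:R) ^+ j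
       - ln x ^+ j.+1 / j.+1%:R <= ln x ^+ j.
Proof.
move=> x1; have x0 : 0 < x by apply: lt_le_trans x1.
set N := Num.truncn x.
have N0 : (0 < N)%N by rewrite truncn_gt0.
have Nx : N%:R <= x by rewrite truncn_le ltW.
have NR : 0 < N%:R :> R by rewrite ltr0n.
have jR : 0 < j.+1%:R :> R by rewrite ltr0n.
have xN : x < N%:R + 1 by rewrite natr1 truncnS_gt.
pose l (n : nat) := ln (x / n%:R).
pose g n := n%:R^-1 * l n ^+ j.
(* [G n] is the integral of ln(x/t)^j / t from [n] to [x]. *)
pose G n := l n ^+ j.+1 / j.+1%:R.
have l0 n : (0 < n <= N)%N -> 0 <= l n.
  move=> /andP[n0 nN]; rewrite ln_ge0// ler_pdivlMr ?ltr0n// mul1r.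
  by rewrite (le_trans _ Nx)// ler_nat.
have l1 : l 1%N = ln x by rewrite /l divr1.
have lB n : (0 < n)%N -> l n - l n.+1 = ln (n.+1%:R / n%:R).
  move=> n0; rewrite /l -ln_div ?posrE ?divr_gt0// ?ltr0n//; congr ln.
  by rewrite -natr1; field; rewrite natr1 !gt_eqF ?ltr0n.
have step n : (0 < n < N)%N -> g n.+1 <= G n - G n.+1 <= g n.
  move=> /andP[n0 nN].
  have ln0 : 0 <= l n by rewrite l0// n0 ltnW.
  have lS0 : 0 <= l n.+1 by rewrite l0.
  have /andP[lo hi] := @ln_succ_itv R n n0; rewrite -lB// in lo hi.
  have le : l n.+1 <= l n by rewrite -subr_ge0; apply: le_trans lo; rewrite invr_ge0.
  have := subrXX_itv (l n) (l n.+1) j; rewrite lS0 le => /(_ isT) /andP[lo' hi'].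
  rewrite /G -mulrBl; apply/andP; split.
    apply: le_trans lo'; rewrite /g mulrC ler_wpM2l ?exprn_ge0//.
  by apply: (le_trans hi'); rewrite /g mulrC ler_wpM2r ?exprn_ge0.
have teles : \sum_(1 <= n < N) (G n - G n.+1) = G 1%N - G N.
  under eq_bigr do rewrite -opprB.
  by rewrite sumrN telescope_sumr// opprB.
(* The leftover piece from [N] to [x] has length below 1. Its upper bound yields the lower half of
   the claim, its nonnegativity the upper half. *)
have GN : 0 <= G N <= g N.
  have lN0 : 0 <= l N by rewrite l0// N0 leqnn.
  rewrite /G /g exprS divr_ge0 ?mulr_ge0 ?exprn_ge0//=.
  rewrite ler_pdivrMr// mulrAC ler_wpM2r ?exprn_ge0//.
  have : l N <= N%:R^-1.
    have -> : l N = ln (1 + (x / N%:R - 1)) by rewrite addrC subrK.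
    have xN1 : 1 <= x / N%:R by rewrite ler_pdivlMr// mul1r.
    apply: le_trans (le_ln1Dx _) _; first by lra.
    by rewrite lerBlDr ler_pdivrMr// mulrDl mulVf ?gt_eqF// mul1r addrC ltW.
  by move/le_trans; apply; rewrite ler_peMr ?invr_ge0// ler1n.
rewrite -l1 -/(G 1%N); apply/andP; split.
  rewrite subr_ge0 big_nat_recr//=.
  have : \sum_(1 <= n < N) (G n - G n.+1) <= \sum_(1 <= n < N) g n.
    by apply: ler_sum_nat => n /step/andP[].
  rewrite teles; move: GN => /andP[]; rewrite /g /l; lra.
rewrite lerBlDr -[leLHS]/(\sum_(1 <= n < N.+1) g n).
rewrite big_ltn// big_add1 /= {1}/g invr1 mul1r lerD2l.
have : \sum_(1 <= n < N) g n.+1 <= \sum_(1 <= n < N) (G n - G n.+1).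
  by apply: ler_sum_nat => n /step/andP[].
rewrite teles; move: GN => /andP[]; rewrite /g /l; lra.
Qed.

(** * Induction on the number of variables *)

Lemma ler_norm_dilation_sum {R : realType} (h e : R -> R) (x : R) : 1 <= x ->
    (forall y, 1 <= y -> `|h y| <= e y) ->
  `|dilation_sum h x| <= dilation_sum e x.
Proof.
move=> x1 he; apply: le_trans (ler_norm_sum _ _ _) _.
apply: ler_sum_nat => n /andP[n0]; rewrite ltnS => nN; apply: he.
rewrite ler_pdivlMr ?ltr0n// mul1r -truncn_ge_nat//.
exact: le_trans x1.
Qed.

Lemma dilation_sumZ {R : realType} (K : R) (h : R -> R) (x : R) :
  dilation_sum (fun y => K * h y) x = K * dilation_sum h x.
Proof. by rewrite mulr_sumr. Qed.

Lemma dilation_sumB {R : realType} (h e : R -> R) (x : R) :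
  dilation_sum (fun y => h y - e y) x = dilation_sum h x - dilation_sum e x.
Proof. by rewrite -sumrB. Qed.

Lemma dilation_sum_lnX {R : realType} (x : R) (j : nat) : 1 <= x ->
  0 <= dilation_sum (fun y => y * ln y ^+ j) x - x * ln x ^+ j.+1 / j.+1%:R
    <= x * ln x ^+ j.
Proof.
move=> x1; have x0 : 0 < x by apply: lt_le_trans x1.
have := sum_inv_lnX x j x1.
rewrite -(ler_pM2l x0) -[in X in _ && X -> _](ler_pM2l x0) mulr0 mulrBr mulrA.
by rewrite /dilation_sum mulr_sumr; under [in X in X -> _]eq_bigr do rewrite mulrA.
Qed.

(** Two iterations form the base case, where the error x^t sums to O(x). The bound must hold down to
    x = 1, as the induction evaluates it at every x/n; hence [1 + ln x], since [ln x] vanishes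
    there. *)
Lemma iter_dilation_sum_asymptotic {R : realType} (h : R -> R) (c K t : R) :
    0 <= t < 1 -> 0 <= K ->
    (forall x, 1 <= x -> `|dilation_sum h x - c * x| <= K * x `^ t) ->
  forall k, exists K', 0 <= K' /\ forall x, 1 <= x ->
    `|iter k.+2 dilation_sum h x - c / k.+1`!%:R * (x * ln x ^+ k.+1)|
      <= K' * (x * (1 + ln x) ^+ k).
Proof.
move=> t01 K0 hK.
have /andP[t0 t1] := t01.
(* One dilation turns b y (ln y)^j into b/(j+1) x (ln x)^(j+1) up to |b| x (ln x)^j; the first term
   on the right is the dilated old error. *)
have main (e : R -> R) (b : R) (j : nat) x : 1 <= x ->
    `|dilation_sum e x - b / j.+1%:R * (x * ln x ^+ j.+1)| <=
    `|dilation_sum (fun y => e y - b * (y * ln y ^+ j)) x| + `|b| * (x * ln x ^+ j).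
  move=> x1; rewrite dilation_sumB dilation_sumZ.
  set D := dilation_sum _ x; set D' := dilation_sum _ x.
  have -> : D - b / j.+1%:R * (x * ln x ^+ j.+1) =
      (D - b * D') + b * (D' - x * ln x ^+ j.+1 / j.+1%:R).
    by field; rewrite addrC natr1 pnatr_eq0.
  apply: le_trans (ler_normD _ _) _; rewrite lerD2l normrM ler_wpM2l//.
  by have /andP[D0 D1] := dilation_sum_lnX x j x1; rewrite ger0_norm.
elim=> [|k [K' [K'0 IH]]].
  exists (K / (1 - t) + `|c|); split.
    by rewrite addr_ge0// divr_ge0//; lra.
  move=> x x1; apply: le_trans (main _ _ _ _ x1) _.
  rewrite !expr0 !mulr1 mulrDl lerD2r.
  apply: (@le_trans _ _ (dilation_sum (fun y => K * y `^ t) x)).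
    by apply: ler_norm_dilation_sum => // y y1; rewrite expr0 mulr1; exact: hK.
  rewrite dilation_sumZ -mulrA [_^-1 * _]mulrC.
  by rewrite ler_wpM2l// sum_powR_dilation.
pose c' := c / k.+1`!%:R.
have cE : c / k.+2`!%:R = c' / k.+2%:R.
  by rewrite /c' factS natrM invfM mulrCA mulrC.
exists (K' + `|c'|); split; first by rewrite addr_ge0.
move=> x x1; rewrite cE; apply: le_trans (main _ _ _ _ x1) _.
have x0 : 0 <= x by apply: le_trans x1.
have L0 := ln_ge0 x1.
rewrite mulrDl lerD//; last first.
  rewrite ler_wpM2l// ler_wpM2l// lerXn2r ?nnegrE ?addr_ge0//.
  by rewrite lerDr.
apply: (@le_trans _ _ (dilation_sum (fun y => K' * (y * (1 + ln y) ^+ k)) x)).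
  exact: ler_norm_dilation_sum.
rewrite dilation_sumZ ler_wpM2l//.
(* Exponent 0 gives the harmonic bound 1 + ln x, which is the extra factor; each 1 + ln(x/n) is then
   bounded by 1 + ln x. *)
have /andP[_] := sum_inv_lnX x 0 x1.
rewrite expr0 expr1 divr1 lerBlDr => H.
rewrite exprS mulrCA mulrA; apply: le_trans (ler_wpM2r _ (ler_wpM2r x0 H)); last first.
  by rewrite exprn_ge0// addr_ge0.
rewrite !mulr_suml; apply: ler_sum_nat => n /andP[n0]; rewrite ltnS => nN.
have nR : 0 < n%:R :> R by rewrite ltr0n.
have xn : 1 <= x / n%:R by rewrite ler_pdivlMr// mul1r -truncn_ge_nat.
rewrite expr0 mulr1 [_^-1 * x]mulrC ler_wpM2l ?divr_ge0//.
rewrite lerXn2r ?nnegrE ?addr_ge0 ?ln_ge0// lerD2l.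
rewrite ler_ln ?posrE ?divr_gt0//; last by apply: lt_le_trans x1.
- by rewrite ler_pdivrMr// ler_peMr// ler1n.
- by apply: lt_le_trans x1.
Qed.

(** * Landau notation and explicit constants *)

(** Adding the finitely many early values to the constant suffices, since n^a >= 1 once n >= 1 and a
    >= 0. *)
Lemma eqO_nat_bound {R : realType} (f : nat -> R) (a : R) : 0 <= a ->
    f =O_\oo (fun n : nat => n%:R `^ a) ->
  exists K, 0 <= K /\ forall n, (0 < n)%N -> `|f n| <= K * n%:R `^ a.
Proof.
move=> a0 /eqO_exP[K K0 [N _ fK]].
exists (K + \sum_(0 <= i < N) `|f i|).
have S0 : 0 <= \sum_(0 <= i < N) `|f i| by apply: sumr_ge0.
split; first by rewrite addr_ge0// ltW.
move=> n n0; have p1 : 1 <= n%:R `^ a :> R.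
  by rewrite -{1}(powRr0 n%:R) ler_powR// ler1n.
rewrite mulrDl; have [Nn|nN] := leqP N n.
  have := fK n Nn; rewrite /= (ger0_norm (powR_ge0 _ _)) => /le_trans; apply.
  by rewrite lerDl mulr_ge0// powR_ge0.
apply: (@le_trans _ _ (\sum_(0 <= i < N) `|f i|)).
  rewrite (bigD1_seq n) ?iota_uniq ?mem_index_iota//=.
  by rewrite lerDl sumr_ge0.
by rewrite ler_wpDl ?mulr_ge0 ?powR_ge0 ?(ltW K0)// ler_peMr.
Qed.

Lemma leading_term_sum {R : realType} (c b L : R) (r : nat) :
  \sum_(0 <= j < r.+1) \sum_(0 <= i < j.+1)
    'C(j, i)%:R * (-1) ^+ i * ((j == r)%:R * b) * ((i == 0)%N%:R * c) * L ^+ (j - i)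
  = c * b * L ^+ r.
Proof.
rewrite big_nat_recr//= big_nat big1 ?add0r => [|j /andP[_ jr]]; last first.
  by rewrite big1// => i _; rewrite (ltn_eqF jr) mul0r mulr0 !mul0r.
rewrite big_nat_recl// big1 ?addr0 => [|i _]; last by rewrite mul0r mulr0 mul0r.
by rewrite bin0 expr0 !eqxx subn0 !mul1r [b * c]mulrC.
Qed.

Theorem theorem1 (R : realType) (r : nat) (f : nat -> R) (alpha beta : R)
    (hr : (2 <= r)%N)
    (halpha : 0 <= alpha < 1)
    (hf : f =O_\oo (fun n : nat => n%:R `^ alpha))
    (hbeta : 0 <= beta)
    (hsum : summatory f =O_+oo (fun x : R => x * ln (ln x) `^ beta)) :
  exists a C : nat -> R,
    Ssum f r =
      (fun x : R => x * \sum_(0 <= j < r) \sum_(0 <= i < j.+1)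
          'C(j, i)%:R * (-1) ^+ i * a j * C i * ln x ^+ (j - i))
      +O_+oo (fun x : R => x * ln x ^+ (r - 2) * ln (ln x) `^ beta).
Proof.
case: r hr => [//|[//|k]] _ {hsum}.
have /andP[a0 a1] := halpha.
have [K [K0 fK]] := eqO_nat_bound f alpha a0 hf.
have [c [K1 [K10 S1]]] := dilation_sum_truncn_asymptotic f alpha K halpha K0 fK.
have t01 : 0 <= (1 + alpha) / 2 < 1 by apply/andP; split; lra.
have [K' [K'0 Sr]] := iter_dilation_sum_asymptotic _ _ _ _ t01 K10 S1 k.
(* With r - 1 = [k.+1], the leading coefficient c/(r-1)! is split as a_(r-1) C_0. *)
exists (fun j => (j == k.+1)%:R * k.+1`!%:R^-1), (fun i => (i == 0)%N%:R * c).
apply/eqaddOP.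
near=> M; near=> x.
(* From e^e on, ln(ln x) >= 1, so its power [beta] is at least 1 and can only enlarge the error
   term. *)
have xe : expR (expR 1) <= x by near: x; apply: nbhs_pinfty_ge; exact: num_real.
have x0 : 0 < x by apply: lt_le_trans xe; exact: expR_gt0.
have Le : expR 1 <= ln x by rewrite -[leLHS]expRK ler_ln ?posrE ?expR_gt0.
have L0 : 0 < ln x by apply: lt_le_trans Le; exact: expR_gt0.
have LL : 1 <= ln (ln x) by rewrite -[leLHS]expRK ler_ln ?posrE ?expR_gt0.
have L1 : 1 <= ln x by apply: le_trans Le; rewrite ltW// expR_gt1.
have x1 : 1 <= x by apply: le_trans xe; rewrite ltW// expR_gt1 expR_gt0.
have B1 : 1 <= ln (ln x) `^ beta by rewrite -(powRr0 (ln (ln x))) ler_powR.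
rewrite !fctE leading_term_sum SsumE// subSS subSS subn0.
rewrite mulrCA.
apply: le_trans (Sr x x1) _.
rewrite ger0_norm ?mulr_ge0 ?exprn_ge0 ?powR_ge0 ?(ltW x0) ?(ltW L0)//.
(* As ln x >= 1, 1 + ln x <= 2 ln x; the k-th power of this costs 2^k. *)
have Kl : K' * 2 ^+ k <= M by near: M; apply: nbhs_pinfty_ge; exact: num_real.
apply: le_trans (ler_wpM2r _ Kl); last first.
  by rewrite ?mulr_ge0 ?exprn_ge0 ?powR_ge0 ?(ltW x0) ?(ltW L0).
rewrite -[leRHS]mulrA ler_wpM2l// -[x * _ * _]mulrA mulrCA ler_wpM2l ?(ltW x0)//.
rewrite mulrA -exprMn -[leLHS]mulr1 ler_pM ?exprn_ge0 ?addr_ge0 ?(ltW L0)//.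
rewrite lerXn2r ?nnegrE ?addr_ge0 ?mulr_ge0 ?(ltW L0)//.
lra.
Unshelve. all: by end_near.
Qed.
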